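(* Every penny graph on $n$ vertices in general position with $e$ edges satisfies $e/n\le 12/5$.
   Context: A penny graph is a graph whose vertex set is a finite set $P$ of points in the Euclidean plane such that every two distinct points of $P$ are at distance at least $1$, and whose edges are exactly the pairs of points of $P$ at distance exactly $1$. The vertices are in general position if no three of them are collinear. *)

(* Defs.v *)
From mathcomp Require Import all_boot all_order all_algebra.
From mathcomp Require Import finmap reals.

Set Implicit Arguments.
Unset Strict Implicit.
Unset Printing Implicit Defensive.

Import Order.TTheory GRing.Theory Num.Theory.
Local Open Scope fset_scope.
Local Open Scope ring_scope.

Definition edist (R : realType) (p q : R * R) : R :=
  Num.sqrt ((p.1 - q.1) ^+ 2 + (p.2 - q.2) ^+ 2).

Definition penny_vertices (R : realType) (P : {fset R * R}) : Prop :=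
  forall p q : R * R, p \in P -> q \in P -> p != q -> 1 <= edist p q.

Definition penny_adj (R : realType) (P : {fset R * R}) : rel P :=
  fun p q => edist (val p) (val q) == 1.

(* Edges are unordered pairs; [penny_adj] is irreflexive since
   [edist p p = 0], so each [ [set p; q] ] below has two elements. *)
Definition penny_edges (R : realType) (P : {fset R * R}) : {set {set P}} :=
  [set e : {set P} |
    [exists p : P, exists q : P, penny_adj p q && (e == [set p; q])]].

(* The points lie on a common line [a x + b y = c], with [(a, b) != (0, 0)]. *)
Definition collinear (R : realType) (p q r : R * R) : Prop :=
  exists a b c : R, (a, b) != (0, 0) /\
    [/\ a * p.1 + b * p.2 = c, a * q.1 + b * q.2 = c & a * r.1 + b * r.2 = c].

Definition general_position (R : realType) (P : {fset R * R}) : Prop :=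
  forall p q r : R * R, p \in P -> q \in P -> r \in P ->
    p != q -> p != r -> q != r -> ~ collinear p q r.

(* Main.v *)
Require Import Defs.
From mathcomp Require Import all_boot all_order all_algebra.
From mathcomp Require Import finmap reals.
From mathcomp Require Import trigo ring lra zify.
Import Order.TTheory GRing.Theory Num.Theory.
Local Open Scope fset_scope.
Local Open Scope ring_scope.

Set Implicit Arguments.
Unset Strict Implicit.
Unset Printing Implicit Defensive.

(** Discharging. A vertex has degree at most 5, since six neighbours would form a
    regular hexagon, which contains antipodal points. If every vertex of degree 5
    has a neighbour of degree at most 4 and sends charge 1/5 to it, then a vertex
    of degree d <= 4 ends up with at most 6d/5 <= 24/5, so the average degree is at
    most 24/5.

    It remains to exclude a vertex v of degree 5 all of whose neighbours have
    degree 5. Write the consecutive angles at such a vertex as 60 + a_i degrees,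
    so that a_i >= 0 and the a_i sum to 60; no two neighbours are antipodal, hence
    a_i + a_(i+1) < 60. If an edge sees the excesses a and b at its two ends on
    one side, then either a = b = 0 (a triangle) or a + b >= 60. Therefore each
    edge at v lies on a triangle and the excesses at v are (0, 0, a, 0, 60 - a) up
    to rotation. Comparing excesses along the edges between the three neighbours
    u1, u2, u3 that span the two adjacent triangles forces all their angles, and
    then v is collinear with a neighbour of u1 and a neighbour of u3. *)

(** * Unit vectors, their angles and distances *)

Definition dir (R : realType) (t : R) : R * R := (cos t, sin t).

Section Directions.
Variable R : realType.
Implicit Types (x y s t u m h a b : R) (p q : R * R).

Lemma cos_pi3 : cos (pi / 3) = 1 / 2 :> R.
Proof.
have pi0 := pi_gt0 R.
have C0 : 0 < cos (pi / 3 : R) by apply: cos_gt0_pihalf; apply/andP; split; lra.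
have E : cos (pi / 3 + pi / 3 + pi / 3) = -1 :> R.
  by rewrite -cospi; congr cos; lra.
have E2 := cos2Dsin2 (pi / 3 : R).
(* Triple-angle formula: [4c^3 - 3c + 1 = (c + 1)(2c - 1)^2]. *)
have F : (cos (pi / 3) + 1) * (2 * cos (pi / 3) - 1) ^+ 2 = 0 :> R.
  rewrite !cosD !sinD in E; nra.
have : cos (pi / 3) + 1 != 0 :> R by rewrite gt_eqF //; lra.
by move/eqP: F; rewrite mulf_eq0 => /orP[-> //|]; rewrite sqrf_eq0 => /eqP F _; lra.
Qed.

Lemma cos_lt x y : 0 <= x -> x < y -> y <= pi -> cos y < cos x.
Proof.
by move=> x0 xy ypi; rewrite ltr_cos // in_itv /=; apply/andP; split; lra.
Qed.

Lemma cos_2piB x : cos (pi *+ 2 - x) = cos x.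
Proof. by rewrite cosB cos2pi sin2pi mul1r mul0r addr0. Qed.

Lemma cos_le_half_range x :
  0 <= x -> x <= pi *+ 2 -> cos x <= 1 / 2 -> pi / 3 <= x <= pi * (5 / 3).
Proof.
move=> x0 x2 xh; have pi0 := pi_gt0 R; apply/andP; split; rewrite leNgt.
  by apply/negP => xl; have := cos_lt x0 xl ltac:(lra); rewrite cos_pi3; lra.
apply/negP => xl; have := @cos_lt (pi *+ 2 - x) (pi / 3).
rewrite cos_2piB cos_pi3; lra.
Qed.

Lemma dirD2pi t : dir (t + pi *+ 2) = dir t.
Proof. by rewrite /dir cosD2pi sinD2pi. Qed.

Lemma dirDpi t : dir (t + pi) = - dir t.
Proof. by rewrite /dir cosDpi sinDpi. Qed.

Lemma dir_add m h :
  dir (m - h) + dir (m + h) = (2 * cos h * cos m, 2 * cos h * sin m).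
Proof.
by apply: injective_projections => /=; rewrite ?cosB ?cosD ?sinB ?sinD; ring.
Qed.

Lemma dir_hexagon t : dir (t - pi / 3) + dir (t + pi / 3) = dir t.
Proof. by rewrite dir_add cos_pi3 /dir; congr pair; lra. Qed.

Lemma dir_eq_cos s t : dir s = dir t -> cos (s - t) = 1.
Proof. by case=> c1 c2; rewrite cosB c1 c2 -!expr2 cos2Dsin2. Qed.

Lemma addp1 p q : (p + q).1 = p.1 + q.1. Proof. by []. Qed.
Lemma addp2 p q : (p + q).2 = p.2 + q.2. Proof. by []. Qed.

Definition sqdist p q : R := (p.1 - q.1) ^+ 2 + (p.2 - q.2) ^+ 2.

Lemma sqdist_dir p s t : sqdist (p + dir s) (p + dir t) = 2 - 2 * cos (s - t).
Proof.
rewrite /sqdist !addp1 !addp2 /= cosB; have := cos2Dsin2 s.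
by have := cos2Dsin2 t; lra.
Qed.

Lemma sqdist_dir2 p s t u : sqdist (p + dir s) (p + dir t + dir u) =
  3 - 2 * cos (s - t) - 2 * cos (s - u) + 2 * cos (t - u).
Proof.
rewrite /sqdist !addp1 !addp2 /= !cosB.
by have := cos2Dsin2 s; have := cos2Dsin2 t; have := cos2Dsin2 u; lra.
Qed.

(** The counterclockwise angle from direction [t] to a unit vector [p]. Here [x] is a coordinate of
    [p] in the frame turned by [t]; the sign of the other one decides whether [acos] must be
    reflected. *)
Definition rel_angle t p : R :=
  let x := p.1 * cos t + p.2 * sin t in
  if 0 <= p.2 * cos t - p.1 * sin t then acos x else pi *+ 2 - acos x.

Lemma rel_angleP t p : p.1 ^+ 2 + p.2 ^+ 2 = 1 ->
  0 <= rel_angle t p < pi *+ 2 /\ dir (t + rel_angle t p) = p.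
Proof.
move=> p1; have := cos2Dsin2 t; rewrite /rel_angle.
set C := cos t; set S := sin t => CS.
set x := p.1 * C + p.2 * S; set y := p.2 * C - p.1 * S.
have xy : x ^+ 2 + y ^+ 2 = 1.
  by rewrite -[RHS]mul1r -{1}p1 -CS /x /y; ring.
have px : C * x - S * y = p.1.
  by rewrite -[RHS]mulr1 -CS /x /y; ring.
have py : S * x + C * y = p.2.
  by rewrite -[RHS]mulr1 -CS /x /y; ring.
have x1 : -1 <= x <= 1 by apply/andP; split; nra.
have [/andP[a0 ap] ac] := acos_def x1.
have as_ : sin (acos x) = `|y|.
  by rewrite sin_acos // -sqrtr_sqr; congr Num.sqrt; lra.
rewrite -/x -/y; case: ifPn => y0.
  split; first by have := pi_gt0 R; rewrite a0 /= mulr2n; lra.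
  rewrite /dir cosD sinD ac as_ ger0_norm // [RHS]surjective_pairing.
  by congr pair; rewrite -/C -/S; lra.
have a_gt0 : 0 < acos x by apply: acos_gt0; apply/andP; split; nra.
split; first by rewrite mulr2n; apply/andP; split; lra.
have -> : t + (pi *+ 2 - acos x) = (t - acos x) + pi *+ 2 by lra.
rewrite dirD2pi /dir cosB sinB ac as_ ler0_norm; last by lra.
by rewrite [RHS]surjective_pairing; congr pair; rewrite -/C -/S; lra.
Qed.

End Directions.

(** * Angles around a vertex and along an edge *)

Section PennyGeometry.
Variables (R : realType) (P : {fset R * R}).
Hypotheses (hP : penny_vertices P) (hgp : general_position P).
Implicit Types (x y p q : R * R) (s t u m a b c d f : R).

Local Notation c60 := (pi / 3 : R).

Lemma edist_sqdist p q : edist p q = Num.sqrt (sqdist p q).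
Proof. by []. Qed.

Lemma penny_sqdist p q : p \in P -> q \in P -> p != q -> 1 <= sqdist p q.
Proof.
move=> pP qP pq; have := hP pP qP pq; rewrite edist_sqdist -{1}sqrtr1.
by rewrite ler_sqrt // addr_ge0 ?sqr_ge0.
Qed.

(** The squared distance is [2 - 2 * cos (t - s)], and it is at least 1 only if the cosine is at
    most 1/2. *)
Lemma penny_gap x s t : x + dir s \in P -> x + dir t \in P ->
  s < t -> t < s + pi *+ 2 -> s + c60 <= t <= s + pi * (5 / 3).
Proof.
move=> sP tP st ts; have pi0 := pi_gt0 R; rewrite mulr2n in ts.
have nst : x + dir s != x + dir t.
  apply/eqP => /addrI/esym/dir_eq_cos.
  have [l|l] := leP (t - s) pi.
    have := @cos_lt _ 0 (t - s); rewrite cos0; lra.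
  have := @cos_lt _ 0 (pi *+ 2 - (t - s)); rewrite cos_2piB cos0 mulr2n; lra.
have := penny_sqdist sP tP nst; rewrite sqdist_dir -cosN opprB => D.
have := @cos_le_half_range _ (t - s); rewrite mulr2n => H.
have /andP[] : c60 <= t - s <= pi * (5 / 3) by apply: H; lra.
by move=> *; apply/andP; split; lra.
Qed.

Lemma no_three_on_line x m k l : x \in P ->
  x + (k * cos m, k * sin m) \in P -> x + (l * cos m, l * sin m) \in P ->
  k != 0 -> l != 0 -> k != l -> False.
Proof.
move=> xP kP lP k0 l0 kl; have cs := cos2Dsin2 m.
have inj k1 k2 : k1 != k2 ->
    x + (k1 * cos m, k1 * sin m) != x + (k2 * cos m, k2 * sin m).
  apply: contra => /eqP/addrI[e1 e2]; apply/eqP.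
  rewrite -[k1]mulr1 -[k2]mulr1 -cs !expr2 !mulrDr !mulrA e1 e2 //.
have x0 : x = x + (0 * cos m, 0 * sin m) by rewrite !mul0r addr0.
apply: (hgp xP kP lP); [by rewrite {1}x0 inj // eq_sym| |by rewrite inj|].
  by rewrite {1}x0 inj // eq_sym.
exists (sin m), (- cos m), (sin m * x.1 - cos m * x.2); split; last first.
  by rewrite !addp1 !addp2 /=; split; ring.
apply/eqP => -[e1 /eqP]; rewrite oppr_eq0 => /eqP e2.
by move: cs; rewrite e1 e2 !expr0n addr0 => /esym/eqP; rewrite oner_eq0.
Qed.

Lemma no_antipodal x s : x \in P -> x + dir s \in P -> x + dir (s + pi) \in P ->
  False.
Proof.
move=> xP sP; rewrite dirDpi => tP.
apply: (@no_three_on_line x s 1 (-1) xP); 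
  rewrite ?mul1r ?mulN1r ?oppr_eq0 ?oner_eq0 //.
by rewrite gt_eqF //; lra.
Qed.

(* [a] and [b] are the excesses over 60 degrees of the angles that the edge from
   [x] to [y] forms with the next edges at [x] and at [y] on the same side. *)
Definition side_ok a b := (a = 0 /\ b = 0) \/ c60 <= a + b.

(** If [a + b] is below 60 degrees, then [h] is acute and [|d| < h], so the two outer points are at
    distance less than 1 and must coincide. Then [4 * cos h * (cos d - cos h) = 1], and [cos d <= 1]
    forces [cos h = 1 / 2], that is [a + b = 0]. *)
Lemma side_okP x y s a b : y = x + dir s -> 0 <= a -> 0 <= b ->
  x + dir (s + (c60 + a)) \in P -> y + dir (s + pi - (c60 + b)) \in P ->
  side_ok a b.
Proof.
move=> -> a0 b0 pP qP; have pi0 := pi_gt0 R; rewrite /side_ok.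
have [|ab] := leP c60 (a + b); [by right|left].
set h := c60 + (a + b) / 2; set d := (a - b) / 2.
have h_gt0 : 0 < cos h by apply: cos_gt0_pihalf; rewrite /h; apply/andP; split; lra.
have dh : cos h < cos d.
  have [d0|d0] := leP 0 d; first by apply: cos_lt; rewrite /h /d in d0 *; lra.
  by rewrite -(cosN d); apply: cos_lt; rewrite /h /d in d0 *; lra.
have D : sqdist (x + dir (s + (c60 + a))) (x + dir s + dir (s + pi - (c60 + b)))
    = 1 - 4 * cos h * (cos d - cos h).
  rewrite sqdist_dir2.
  have -> : s + (c60 + a) - s = h + d by rewrite /h /d; lra.
  have -> : s + (c60 + a) - (s + pi - (c60 + b)) = (h + h) - pi by rewrite /h; lra.
  have -> : s - (s + pi - (c60 + b)) = (h - d) - pi by rewrite /h /d; lra.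
  rewrite !(cosB _ pi) cospi sinpi (cosB h d) (cosD h d) (cosD h h).
  have := cos2Dsin2 h; lra.
have d1 := cos_le1 d.
have [E|N] := eqVneq (x + dir (s + (c60 + a))) (x + dir s + dir (s + pi - (c60 + b))).
  have D0 : 1 - 4 * cos h * (cos d - cos h) = 0.
    by rewrite -D E /sqdist !subrr expr0n addr0.
  have ch : cos h = 1 / 2.
    suff: (cos h - 1 / 2) ^+ 2 <= 0.
      by rewrite le_eqVlt ltNge sqr_ge0 orbF sqrf_eq0 => /eqP; lra.
    nra.
  have [h60|h60] := leP h c60; first by split; rewrite /h in h60; lra.
  by have := @cos_lt _ c60 h; rewrite cos_pi3 ch /h; lra.
have := penny_sqdist pP qP N; rewrite D.
nra.
Qed.

Lemma eq_dir_mem x s t : s = t -> x + dir s \in P -> x + dir t \in P.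
Proof. by move=> ->. Qed.

(* The five neighbours of [x] are in directions [t] (first), and then each
   [60 + a_i] degrees counterclockwise from the previous one. *)
Definition star x t a0 a1 a2 a3 a4 : Prop :=
  [/\ [/\ 0 <= a0, 0 <= a1, 0 <= a2, 0 <= a3 & 0 <= a4],
      a0 + a1 + a2 + a3 + a4 = c60,
      [/\ a0 + a1 < c60, a1 + a2 < c60, a2 + a3 < c60, a3 + a4 < c60
        & a4 + a0 < c60] &
      [/\ x + dir t \in P, x + dir (t + (c60 + a0)) \in P,
          x + dir (t + (2 * c60 + a0 + a1)) \in P,
          x + dir (t + (3 * c60 + a0 + a1 + a2)) \in P &
          x + dir (t + (4 * c60 + a0 + a1 + a2 + a3)) \in P]].

Lemma star_rot x t a0 a1 a2 a3 a4 : star x t a0 a1 a2 a3 a4 ->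
  star x (t + (c60 + a0)) a1 a2 a3 a4 a0.
Proof.
case=> -[h0 h1 h2 h3 h4] sa [s0 s1 s2 s3 s4] [p0 p1 p2 p3 p4].
split=> //; first by lra.
split; first by [].
- by apply: eq_dir_mem p2; lra.
- by apply: eq_dir_mem p3; lra.
- by apply: eq_dir_mem p4; lra.
- by move: p0; rewrite -dirD2pi; apply: eq_dir_mem; rewrite mulr2n; lra.
Qed.

Lemma star_edge x y s t a0 a1 a2 a3 a4 b0 b1 b2 b3 b4 :
  y = x + dir s -> t = s + pi ->
  star x s a0 a1 a2 a3 a4 -> star y t b0 b1 b2 b3 b4 ->
  side_ok a0 b4 /\ side_ok b0 a4.
Proof.
move=> ys ts [[h0 h1 h2 h3 h4] sa _ [p0 p1 p2 p3 p4]].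
move=> [[k0 k1 k2 k3 k4] sb _ [q0 q1 q2 q3 q4]].
have xt : x = y + dir t by rewrite ys ts dirDpi addrK.
split.
  apply: (side_okP ys) => //.
  by rewrite -dirD2pi; apply: eq_dir_mem q4; rewrite mulr2n; lra.
apply: (side_okP xt) => //.
by apply: eq_dir_mem p4; lra.
Qed.

Definition pentavalent x : Prop := x \in P /\
  forall t, x + dir t \in P -> exists a0 a1 a2 a3 a4, star x t a0 a1 a2 a3 a4.

(** * A vertex of degree 5 with all neighbours of degree 5 *)

Section AllPentavalent.
Variable v : R * R.
Hypothesis v5 : pentavalent v.
Hypothesis nbr5 : forall t, v + dir t \in P -> pentavalent (v + dir t).

Lemma star_nbr t a0 a1 a2 a3 a4 : star v t a0 a1 a2 a3 a4 ->
  exists b0 b1 b2 b3 b4, star (v + dir t) (t + pi) b0 b1 b2 b3 b4 /\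
    (side_ok a0 b4 /\ side_ok b0 a4).
Proof.
move=> S; have [_ _ _ [tP _ _ _ _]] := S.
have [_ /(_ (t + pi))] := nbr5 tP; rewrite dirDpi addrK => /(_ v5.1).
move=> [b0 [b1 [b2 [b3 [b4 Sb]]]]]; exists b0, b1, b2, b3, b4; split=> //.
exact: star_edge erefl erefl S Sb.
Qed.

(** With no triangle on either side, [a0 + b4] and [b0 + a4] would total at least 120 degrees, while
    [a4 + a0] and [b4 + b0] are each below 60. *)
Lemma edge_on_triangle t a0 a1 a2 a3 a4 : star v t a0 a1 a2 a3 a4 ->
  a0 = 0 \/ a4 = 0.
Proof.
move=> S.
have [b0 [b1 [b2 [b3 [b4 [[_ _ [s0 s1 s2 s3 s4] _] ss]]]]]] := star_nbr S.
case: S => _ _ [r0 r1 r2 r3 r4] _.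
by have [[[? _]|?] [[_ ?]|?]] := ss; [left|left|right|lra].
Qed.

(** The letters [f], [b], [d] denote the excesses at u1, u2, u3, counted from the edge back to
    [v]. *)
Lemma two_triangles_False t a0 a1 a2 a3 a4 :
  star v t a0 a1 a2 a3 a4 -> a0 = 0 -> a1 = 0 -> False.
Proof.
move=> S a00 a10; have pi0 := pi_gt0 R.
have S1 := star_rot S; have S2 := star_rot S1; have S3 := star_rot S2.
have a3a2 := edge_on_triangle S3.
have [f0 [f1 [f2 [f3 [f4 [Sf [e1 e2]]]]]]] := star_nbr S.
have [b0 [b1 [b2 [b3 [b4 [Sb [e3 e4]]]]]]] := star_nbr S1.
have [d0 [d1 [d2 [d3 [d4 [Sd [e5 e6]]]]]]] := star_nbr S2.
(* Four rotations bring the last neighbour to the front: once [f4] and [b4] vanish, these stars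
   start along the edges from u1 to u2 and from u2 to u3. *)
have Sf4 := star_rot (star_rot (star_rot (star_rot Sf))).
have Sb4 := star_rot (star_rot (star_rot (star_rot Sb))).
have [[A0 A1 A2 A3 A4] As [A01 A12 A23 A34 A40] _] := S.
have [[F0 F1 F2 F3 F4] Fs [F01 F12 F23 F34 F40] [_ wP _ _ _]] := Sf.
have [[B0 B1 B2 B3 B4] Bs [B01 B12 B23 B34 B40] _] := Sb.
have [[D0 D1 D2 D3 D4] Ds [D01 D12 D23 D34 D40] [_ _ _ tP _]] := Sd.
(* A zero excess at one end forces zero at the other, since a single excess is below 60 degrees. *)
have f40 : f4 = 0 by clear -e1 a00 F4 F34 F3; case: e1 => [[]|]; lra.
have b40 : b4 = 0 by clear -e3 a10 B3 B34 B4; case: e3 => [[]|]; lra.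
have b00 : b0 = 0 by clear -e4 a00 B0 B01 B1; case: e4 => [[]|]; lra.
have d00 : d0 = 0 by clear -e6 a10 D0 D01 D1; case: e6 => [[]|]; lra.
have a30 : a3 = 0 by clear -a3a2 a00 a10 As A40 A34; case: a3a2 => // ?; lra.
have [e7 _] : side_ok d1 b3 /\ side_ok b4 d0.
  apply: star_edge _ _ (star_rot Sd) Sb4; last by clear -a00 a10 Bs b40 d00; lra.
  rewrite -addrA a00 a10 d00 !addr0; congr (_ + _).
  have -> : t + c60 + c60 + pi + c60 = (t + c60 - c60) + pi *+ 2 by lra.
  by rewrite dirD2pi addrC dir_hexagon.
have [e8 _] : side_ok b1 f3 /\ side_ok f4 b0.
  apply: star_edge _ _ (star_rot Sb) Sf4; last by clear -a00 Fs f40 b00; lra.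
  rewrite -addrA a00 b00 !addr0; congr (_ + _).
  have -> : t + c60 + pi + c60 = (t - c60) + pi *+ 2 by lra.
  by rewrite dirD2pi addrC dir_hexagon.
clear S S1 S2 S3 Sf Sb Sd Sf4 Sb4 e1 e3 e4 e6 a3a2.
(* In each of these four pairs a zero excess would leave two adjacent excesses summing to 60
   degrees, so the triangle case is excluded. *)
have E2 : c60 <= f0 + a4.
  by clear -e2 As a00 a10 a30 A23; case: e2 => // -[]; lra.
have E5 : c60 <= a2 + d4.
  by clear -e5 As a00 a10 a30 A40; case: e5 => // -[]; lra.
have E7 : c60 <= d1 + b3.
  by clear -e7 Bs b00 b40 B12; case: e7 => // -[]; lra.
have E8 : c60 <= b1 + f3.
  by clear -e8 Bs b00 b40 B23; case: e8 => // -[]; lra.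
clear e2 e5 e7 e8.
(* The bounds close up into [a2 <= f0 <= b1 <= d1 <= a2], so equality holds throughout. *)
have b3E : b3 <= c60 - a2.
  by clear -As Bs Fs B2 B0 B4 F1 F2 F4 E2 E8 a00 a10 a30; lra.
have f0E : f0 = a2.
  by clear -As Bs Fs Ds E2 E5 E7 E8 B0 B2 B4 F1 F2 F4 D0 D2 D3 a00 a10 a30; lra.
have d1E : d1 = a2 by clear -b3E E7 E5 Ds D0 D2 D3; lra.
have d2E : d2 = 0 by clear -d1E E5 Ds D0 D2 D3; lra.
have a2_lt : a2 < c60 by rewrite a10 add0r in A12.
move: wP tP; rewrite a00 a10 f0E d00 d1E d2E !addr0 => wP tP.
clear - hP nbr5 pi0 v5 A2 a2_lt wP tP hgp.
(* Seen from [v], both far points are sums of two unit vectors, hence lie on the bisector of their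
   directions; both bisectors lie on the line of direction [m]. *)
pose m := t + 2 * c60 + a2 / 2.
apply: (@no_three_on_line v m (2 * cos (2 * c60 + a2 / 2)) (2 * cos (a2 / 2)) v5.1).
- rewrite -dir_add addrA.
  have <- : t = m - (2 * c60 + a2 / 2) by rewrite /m; lra.
  by apply: eq_dir_mem wP; rewrite /m; lra.
- rewrite -dir_add addrA.
  have <- : t + c60 + c60 = m - a2 / 2 by rewrite /m; lra.
  by rewrite -[dir (m + _)]dirD2pi; apply: eq_dir_mem tP; rewrite /m; lra.
- have : 0 < cos (pi - (2 * c60 + a2 / 2)).
    by apply: cos_gt0_pihalf; apply/andP; split; lra.
  by rewrite cosB cospi sinpi => *; rewrite lt_eqF //; lra.
- have : 0 < cos (a2 / 2) by apply: cos_gt0_pihalf; apply/andP; split; lra.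
  by move=> *; rewrite gt_eqF //; lra.
- have : cos (2 * c60 + a2 / 2) < cos (a2 / 2) by apply: cos_lt; lra.
  by move=> *; rewrite lt_eqF //; lra.
Qed.

Lemma no_all_pentavalent t : v + dir t \in P -> False.
Proof.
move=> tP; have [a0 [a1 [a2 [a3 [a4 S0]]]]] := v5.2 _ tP.
have S1 := star_rot S0; have S2 := star_rot S1.
have S3 := star_rot S2; have S4 := star_rot S3.
have := edge_on_triangle S0; have := edge_on_triangle S1.
have := edge_on_triangle S2; have := edge_on_triangle S3.
have := edge_on_triangle S4.
have := two_triangles_False S0; have := two_triangles_False S1.
have := two_triangles_False S2; have := two_triangles_False S3.
have := two_triangles_False S4.
(* Every cyclically consecutive pair of excesses contains a zero; the 5-cycle being odd, some two
   consecutive ones both vanish. *)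
by tauto.
Qed.

End AllPentavalent.
End PennyGeometry.

(** * Vertex degrees, edge counting and discharging *)

Section Degrees.
Variables (R : realType) (P : {fset R * R}).
Hypotheses (hP : penny_vertices P) (hgp : general_position P).
Implicit Types (x y : P).

Local Notation c60 := (pi / 3 : R).

Definition nbrs x : {set P} := [set y | penny_adj x y].

Lemma penny_adjE x y : penny_adj x y = (sqdist (val x) (val y) == 1).
Proof.
rewrite /penny_adj edist_sqdist -{1}sqrtr1 eqr_sqrt //.
by rewrite addr_ge0 ?sqr_ge0.
Qed.

Lemma penny_adjC x y : penny_adj x y = penny_adj y x.
Proof. by rewrite !penny_adjE /sqdist -(opprB (val y).1) -(opprB (val y).2) !sqrrN. Qed.

Lemma penny_adj_unit x y : penny_adj x y ->
  (val y - val x).1 ^+ 2 + (val y - val x).2 ^+ 2 = 1.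
Proof. by rewrite penny_adjC penny_adjE => /eqP. Qed.

Lemma adj_dir_exists x y : y \in nbrs x -> exists t : R, val x + dir t \in P.
Proof.
rewrite inE => /penny_adj_unit/(@rel_angleP _ 0)[_ E].
by exists (0 + rel_angle 0 (val y - val x)); rewrite E addrC subrK; exact: valP.
Qed.

Lemma penny_adj_dir x y t : val y = val x + dir t -> penny_adj x y.
Proof.
move=> E; rewrite penny_adjE E /sqdist !addp1 !addp2 /=.
by rewrite !opprD !addNKr !sqrrN cos2Dsin2.
Qed.

(** The neighbour in direction [t] has relative angle 0 and heads the sorted list; [s] is the tail,
    hence one element shorter. *)
Lemma sorted_nbr_angles x (t : R) : val x + dir t \in P ->
  exists s : seq R, [/\ (size s).+1 = #|nbrs x|, path <%R 0 s,
    {in s, forall r, r < pi *+ 2} & {in s, forall r, val x + dir (t + r) \in P}].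
Proof.
move=> tP; pose A y := rel_angle t (val y - val x).
have AP y : y \in nbrs x -> 0 <= A y < pi *+ 2 /\ val x + dir (t + A y) = val y.
  rewrite inE => /penny_adj_unit/(@rel_angleP _ t)[A1 A2].
  by split=> //; rewrite A2 addrC subrK.
pose s := sort <=%R [seq A y | y <- enum (nbrs x)].
have sP r : r \in s -> [/\ 0 <= r, r < pi *+ 2 & val x + dir (t + r) \in P].
  rewrite mem_sort => /mapP[y]; rewrite mem_enum => /AP[/andP[y1 y2] yE] ->.
  by split=> //; rewrite yE; exact: valP.
have s_size : size s = #|nbrs x| by rewrite size_sort size_map -cardE.
have s_lt : sorted <%R s.
  rewrite sort_lt_sorted map_inj_in_uniq ?enum_uniq // => y z.
  rewrite !mem_enum => /AP[_ yE] /AP[_ zE] yz.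
  by apply: val_inj; rewrite /= -yE -zE yz.
have s0 : 0 \in s.
  pose u : P := [` tP]; have ux : u \in nbrs x by rewrite inE (@penny_adj_dir _ _ t).
  rewrite mem_sort; apply/mapP; exists u; first by rewrite mem_enum.
  have [/andP[A0 A1] /addrI/dir_eq_cos] := AP _ ux.
  rewrite addrAC subrr add0r => cA; apply/eqP; rewrite eq_le A0 leNgt.
  apply/negP => A_gt0; have pi0 := pi_gt0 R.
  have [l|l] := leP (A u) pi; first by have := @cos_lt _ 0 (A u); rewrite cos0; lra.
  have := @cos_lt _ 0 (pi *+ 2 - A u); rewrite cos_2piB cos0; lra.
case: s => [|r s] // in sP s_size s_lt s0 *.
have r0 : r = 0.
  have [+ _ _] := sP r (mem_head _ _); move: s0; rewrite inE => /predU1P[-> //|].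
  by move=> /(allP (order_path_min lt_trans s_lt)) /= rl rg; lra.
exists s; split=> //; first by rewrite -r0.
  by move=> q qs; have [] := sP q ltac:(by rewrite inE qs orbT).
by move=> q qs; have [] := sP q ltac:(by rewrite inE qs orbT).
Qed.

Lemma deg_le5 x : (#|nbrs x| <= 5)%N.
Proof.
have [->|[u /adj_dir_exists[t tP]]] := set_0Vmem (nbrs x); first by rewrite cards0.
have [s [<- + sl sP]] := sorted_nbr_angles tP.
case: s sl sP => [|t1 [|t2 [|t3 [|t4 [|t5 s]]]]] // sl sP.
move=> /= /and5P[l1 l2 l3 l4 /andP[l5 _]].
have t5l : t5 < pi *+ 2 by apply: sl; rewrite !inE eqxx !orbT.
have P1 : val x + dir (t + t1) \in P by apply: sP; rewrite !inE eqxx ?orbT.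
have P2 : val x + dir (t + t2) \in P by apply: sP; rewrite !inE eqxx ?orbT.
have P3 : val x + dir (t + t3) \in P by apply: sP; rewrite !inE eqxx ?orbT.
have P4 : val x + dir (t + t4) \in P by apply: sP; rewrite !inE eqxx ?orbT.
have P5 : val x + dir (t + t5) \in P by apply: sP; rewrite !inE eqxx ?orbT.
have /andP[g1 _] := penny_gap hP tP P1 ltac:(lra) ltac:(lra).
have /andP[g2 _] := penny_gap hP P1 P2 ltac:(lra) ltac:(lra).
have /andP[g3 _] := penny_gap hP P2 P3 ltac:(lra) ltac:(lra).
have /andP[g4 _] := penny_gap hP P3 P4 ltac:(lra) ltac:(lra).
have /andP[g5 _] := penny_gap hP P4 P5 ltac:(lra) ltac:(lra).
have /andP[_ g6] := penny_gap hP tP P5 ltac:(lra) ltac:(lra).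
case: (no_antipodal hgp (valP x) tP).
by apply: eq_dir_mem P3; lra.
Qed.

Lemma deg5_pentavalent x : #|nbrs x| = 5 -> pentavalent P (val x).
Proof.
move=> x5; split=> [|t tP]; first exact: valP.
have [s [+ + sl sP]] := sorted_nbr_angles tP; rewrite x5.
case: s sl sP => [|t1 [|t2 [|t3 [|t4 [|]]]]] // sl sP _.
move=> /= /and5P[l1 l2 l3 l4 _].
have t4l : t4 < pi *+ 2 by apply: sl; rewrite !inE eqxx !orbT.
have P1 : val x + dir (t + t1) \in P by apply: sP; rewrite !inE eqxx ?orbT.
have P2 : val x + dir (t + t2) \in P by apply: sP; rewrite !inE eqxx ?orbT.
have P3 : val x + dir (t + t3) \in P by apply: sP; rewrite !inE eqxx ?orbT.
have P4 : val x + dir (t + t4) \in P by apply: sP; rewrite !inE eqxx ?orbT.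
have /andP[g1 _] := penny_gap hP tP P1 ltac:(lra) ltac:(lra).
have /andP[g2 _] := penny_gap hP P1 P2 ltac:(lra) ltac:(lra).
have /andP[g3 _] := penny_gap hP P2 P3 ltac:(lra) ltac:(lra).
have /andP[g4 _] := penny_gap hP P3 P4 ltac:(lra) ltac:(lra).
have /andP[_ g5] := penny_gap hP tP P4 ltac:(lra) ltac:(lra).
have no_anti r q : val x + dir r \in P -> val x + dir q \in P -> q - r != pi.
  move=> rP qP; apply/eqP => E; apply: (no_antipodal hgp (valP x) rP).
  by apply: eq_dir_mem qP; lra.
have N02 := no_anti _ _ tP P2; have N03 := no_anti _ _ tP P3.
have N13 := no_anti _ _ P1 P3; have N14 := no_anti _ _ P1 P4.
have N24 := no_anti _ _ P2 P4.
exists (t1 - c60), (t2 - t1 - c60), (t3 - t2 - c60), (t4 - t3 - c60).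
exists (5 * c60 - t4).
split; [by split; lra|by lra| |].
  (* The gaps give the weak inequalities; equality would make two neighbours antipodal. *)
  split; rewrite lt_neqAle; (apply/andP; split; last by lra).
  - by apply: contra N02 => /eqP E; apply/eqP; lra.
  - by apply: contra N13 => /eqP E; apply/eqP; lra.
  - by apply: contra N24 => /eqP E; apply/eqP; lra.
  - by apply: contra N03 => /eqP E; apply/eqP; lra.
  - by apply: contra N14 => /eqP E; apply/eqP; lra.
split=> //.
- by apply: eq_dir_mem P1; lra.
- by apply: eq_dir_mem P2; lra.
- by apply: eq_dir_mem P3; lra.
- by apply: eq_dir_mem P4; lra.
Qed.

Lemma deg5_has_small_nbr x : #|nbrs x| = 5 ->
  exists2 y, y \in nbrs x & (#|nbrs y| <= 4)%N.
Proof.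
move=> x5; apply/exists_inP; apply: contraT => /exists_inPn big.
have /card_gt0P[u /adj_dir_exists[t tP]] : (0 < #|nbrs x|)%N by rewrite x5.
case: (no_all_pentavalent hP hgp (deg5_pentavalent x5) _ tP) => r rP.
apply: (@deg5_pentavalent [` rP]).
have /big : [` rP] \in nbrs x by rewrite inE (@penny_adj_dir _ _ r).
have := deg_le5 [` rP]; lia.
Qed.

(** Double counting of incidences: the edges at [x] are among the images of its neighbours under [y
    |-> [set x; y]]. *)
Lemma sum_edge_card : (2 * #|penny_edges P| <= \sum_x #|nbrs x|)%N.
Proof.
have -> : (2 * #|penny_edges P| = \sum_(e in penny_edges P) \sum_(x in e) 1)%N.
  rewrite mulnC -sum_nat_const; apply: eq_bigr => e.
  rewrite inE => /existsP[p /existsP[q /andP[pq /eqP ->]]].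
  rewrite sum1_card cards2; case: eqVneq pq => // ->.
  by rewrite penny_adjE /sqdist !subrr expr0n addr0 eq_sym oner_eq0.
rewrite (exchange_big_dep predT) //=; apply: leq_sum => x _.
rewrite sum1dep_card.
apply: leq_trans (leq_imset_card (fun y => [set x; y]) (nbrs x)).
apply: subset_leq_card; apply/subsetP => e; rewrite inE => /andP[].
rewrite inE => /existsP[p /existsP[q /andP[pq /eqP ->]]].
rewrite !inE => /orP[] /eqP ->; apply/imsetP.
  by exists q; rewrite ?inE.
by exists p; rewrite ?inE 1?penny_adjC // setUC.
Qed.

Lemma sum_deg_le : (5 * \sum_x #|nbrs x| <= 24 * #|{: P}|)%N.
Proof.
pose D5 x := #|nbrs x| == 5.
(* With charges scaled by 5, each degree-5 vertex sends one unit to a smaller neighbour, which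
   receives at most its degree. *)
have D5_le : (\sum_(x | D5 x) 1 <= \sum_(y | ~~ D5 y) #|nbrs y|)%N.
  apply: leq_trans (_ : \sum_(x | D5 x) \sum_(y in nbrs x | ~~ D5 y) 1 <= _)%N.
    apply: leq_sum => x /eqP/deg5_has_small_nbr[y yx y4].
    by rewrite (bigD1 y) //= yx /D5; lia.
  rewrite (exchange_big_dep (fun y => ~~ D5 y)) /=; last by move=> ? ? _ /andP[].
  apply: leq_sum => y _; rewrite sum1dep_card; apply: subset_leq_card.
  by apply/subsetP => x; rewrite !inE penny_adjC => /and3P[].
have -> : #|{: P}| = (\sum_(x : P) 1)%N by rewrite sum1_card.
rewrite !big_distrr /= (bigID D5) /= [leqRHS](bigID D5) /=.
(* A degree-5 vertex holds 25 = 24 + 1; any other ends with at most [5d + d <= 24]. *)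
have -> : (\sum_(x | D5 x) 5 * #|nbrs x| =
    \sum_(x | D5 x) 24 * 1 + \sum_(x | D5 x) 1)%N.
  by rewrite -big_split; apply: eq_bigr => x /eqP ->.
rewrite -addnA leq_add2l; apply: leq_trans (leq_add D5_le (leqnn _)) _.
rewrite -big_split /=; apply: leq_sum => y /eqP y5.
move: (deg_le5 y) y5; case: #|nbrs y| => [|[|[|[|[|[|k]]]]]] //.
Qed.

End Degrees.

Theorem theorem4 (R : realType) (P : {fset R * R}) (n e : nat)
    (hP : penny_vertices P) (hgp : general_position P)
    (hn : n = #|` P|) (he : e = #|penny_edges P|) :
  e%:R / n%:R <= 12 / 5 :> R.
Proof.
have := sum_deg_le hP hgp; have := sum_edge_card P.
rewrite -cardfE -hn -he => e1 e2.
(* For the empty graph the quotient is 0, as the inverse of 0 is 0. *)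
have [->|n0] := posnP n; first by rewrite invr0 mulr0; lra.
rewrite ler_pdivrMr ?ltr0n // mulrAC ler_pdivlMr ?ltr0n //.
by rewrite -!natrM ler_nat; lia.
Qed.
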